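(* For every boolean function $f$ and every $g(n)=\Omega(\log n)$ there exists a distributed language $L_f$ such that, for every $k\ge 1$, $L_f\in\Lambda^G_k(g(n))$ if and only if $f$ is in the $k$th level of the communication complexity hierarchy with $O(g(n))$ bits of nondeterminism, i.e. $f\in\Sigma_k^{\mathrm{cc}}(O(g(n)))$ for $k$ odd, respectively $f\in\Pi_k^{\mathrm{cc}}(O(g(n)))$ for $k$ even.
   Context: Communication complexity hierarchy. A boolean function $f$ is given, for each $n$, on $2n$ bits: $f:\{0,1\}^n\times\{0,1\}^n\to\{0,1\}$; Alice receives $x\in\{0,1\}^n$ and Bob receives $y\in\{0,1\}^n$. A prover and a disprover alternately give advice strings $\ell_1,\dots,\ell_k$ of $s(n)$ bits each, seen by both Alice and Bob. $f\in\Sigma_k^{\mathrm{cc}}(s(n))$ if there are an algorithm $A$ for Alice and an algorithm $B$ for Bob (both computationally unlimited) such that for all $x,y$: $f(x,y)=1$ if and only if $\exists \ell_1\forall \ell_2\cdots \mathrm{Q}\,\ell_k:\ A(\ell_1,\dots,\ell_k,x)=B(\ell_1,\dots,\ell_k,y)=1$, where the quantifiers alternate and $\mathrm{Q}$ is existential if $k$ is odd and universal otherwise. $\Pi_k^{\mathrm{cc}}(s(n))$ is defined in the same way with the disprover (universal quantifier) going first. Hierarchy for global certificates. A network is a finite connected simple graph without loops; its nodes carry pairwise distinct identifiers in a range polynomial in the number of nodes; nodes and edges may carry inputs. A distributed language is a set of graphs with inputs (membership does not depend on identifiers). A verifier is a local algorithm of constant radius $r$: each node sees the graph structure, identifiers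 and inputs in its $r$-neighborhood, together with all global certificates, and accepts or rejects; the verifier does not know the size of the graph. For a size bound $g(n)$, $n$ being here the number of nodes, a language $L$ is in $\Sigma^G_k(g(n))$ if there is a verifier $A$ such that for every graph $G$ with inputs $x$: $(G,x)\in L\iff \exists \ell_1\forall \ell_2\cdots \mathrm{Q}\,\ell_k\ \forall v\in V(G):\ A$ accepts at $v$, where each $\ell_i$ is a single global certificate of $O(g(n))$ bits seen by all nodes, the quantifiers alternate, and $\mathrm{Q}$ is existential if $k$ is odd and universal otherwise. $\Pi^G_k(g(n))$ is defined in the same way with the universal quantifier first. $\Lambda^G_k(g(n))$ denotes $\Sigma^G_k(g(n))$ for odd $k$ and $\Pi^G_k(g(n))$ for even $k$. *)

(* Defs.v *)
From HB Require Import structures.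
From mathcomp Require Import all_boot all_order all_algebra finmap.
From mathcomp Require Import all_classical all_reals all_analysis.

Set Implicit Arguments.
Unset Strict Implicit.
Unset Printing Implicit Defensive.

Import Order.TTheory GRing.Theory Num.Theory.
Import numFieldNormedType.Exports.

Local Open Scope classical_set_scope.
Local Open Scope ring_scope.

Definition bits : Type := seq bool.

(* [quant b k D P] is the prefix of [k] alternating quantifiers
   Q l_1 Q' l_2 ..., each ranging over the strings satisfying [D] and the first
   one existential iff [b], applied to [P [:: l_1; ...; l_k]]. *)
Fixpoint quant (b : bool) (k : nat) (D : bits -> Prop) (P : seq bits -> Prop)
    : Prop :=
  if k is k'.+1 then
    if b then exists2 l, D l & quant false k' D (fun ls => P (l :: ls))
    else forall l, D l -> quant true k' D (fun ls => P (l :: ls))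
  else P [::].

Definition bigO_of (R : realType) (g : nat -> R) (s : nat -> nat) : Prop :=
  (fun n => (s n)%:R : R) =O_\oo g.

Definition boolean_function : Type :=
  forall n : nat, n.-tuple bool -> n.-tuple bool -> bool.

(* The protocols are arbitrary functions, possibly different for each input
   length [n]. *)
Definition cc_level (b : bool) (k : nat) (s : nat -> nat)
    (f : boolean_function) : Prop :=
  exists A B : forall n : nat, seq bits -> n.-tuple bool -> bool,
    forall (n : nat) (x y : n.-tuple bool),
      f n x y = true <->
      quant b k (fun l => size l = s n)
        (fun ls => A n ls x = true /\ B n ls y = true).

Definition Sigma_cc := cc_level true.
Definition Pi_cc := cc_level false.

Definition Sigma_cc_O (R : realType) (k : nat) (g : nat -> R)
    (f : boolean_function) : Prop :=
  exists2 s, bigO_of g s & Sigma_cc k s f.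

Definition Pi_cc_O (R : realType) (k : nat) (g : nat -> R)
    (f : boolean_function) : Prop :=
  exists2 s, bigO_of g s & Pi_cc k s f.

(* Absent inputs are empty strings. The value of [edge_input] on pairs of
   non-adjacent nodes carries no information: it is ignored by [network_iso]
   and by [local_view]. *)
Record network := Network {
  node :> finType;
  adj : rel node;
  node_input : node -> bits;
  edge_input : node -> node -> bits;
  adj_sym : symmetric adj;
  adj_irr : irreflexive adj;
  edge_input_sym : forall u v, edge_input u v = edge_input v u;
  node_gt0 : (0 < #|node|)%N;
  adj_connected : forall u v, connect adj u v
}.

Definition network_iso (G H : network) : Prop :=
  exists phi : G -> H,
    [/\ bijective phi,
        forall u v, adj (phi u) (phi v) = adj u v,
        forall u, node_input (phi u) = node_input u
      & forall u v, adj u v -> edge_input (phi u) (phi v) = edge_input u v].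

Record language := Language {
  in_language :> network -> Prop;
  language_iso : forall G H, network_iso G H -> in_language G -> in_language H
}.

(* [N n] bounds the identifiers of the networks with [n] nodes; [n <= N n] says
   that there are enough identifiers. *)
Definition polynomial_range (N : nat -> nat) : Prop :=
  (forall n, n <= N n)%N /\ exists p : {poly nat}, forall n, (N n <= p.[n])%N.

Definition identifiers (N : nat -> nat) (G : network) (id : G -> nat) : Prop :=
  injective id /\ forall v, (id v < N #|G|)%N.

Fixpoint nbhd (G : network) (r : nat) (v : G) : {set G} :=
  if r is r'.+1 then
    (nbhd r' v :|: [set w | [exists u in nbhd r' v, adj u w]])%SET
  else [set v]%SET.

(* A node names the nodes that it sees by their identifiers. *)
Record view := View {
  self : nat;
  seen_nodes : {fset nat * bits};
  seen_edges : {fset nat * nat * bits}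
}.

Definition local_view (G : network) (id : G -> nat) (r : nat) (v : G) : view :=
  View (id v)
    [fset (id u, node_input u) | u in nbhd r v]%fset
    [fset (id e.1, id e.2, edge_input e.1 e.2)
       | e in [pred e : G * G | [&& e.1 \in nbhd r v, e.2 \in nbhd r v
                                  & adj e.1 e.2]]]%fset.

(* The verifier has constant radius [r] and is an arbitrary function of the view
   and of the certificates; the certificates have at most [s n] bits, so that
   their lengths do not reveal the number [n] of nodes. *)
Definition global_level (R : realType) (N : nat -> nat) (b : bool) (k : nat)
    (g : nat -> R) (L : language) : Prop :=
  exists2 s : nat -> nat, bigO_of g s &
  exists (r : nat) (A : view -> seq bits -> bool),
    forall (G : network) (id : G -> nat), identifiers N id ->
      (L G <->
       quant b k (fun l => (size l <= s #|G|)%N)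
         (fun ls => forall v : G, A (local_view id r v) ls = true)).

Definition Sigma_G (R : realType) (N : nat -> nat) :=
  @global_level R N true.
Definition Pi_G (R : realType) (N : nat -> nat) :=
  @global_level R N false.

Definition Lambda_G (R : realType) (N : nat -> nat) (k : nat) (g : nat -> R)
    (L : language) : Prop :=
  if odd k then Sigma_G N k g L else Pi_G N k g L.

(* Main.v *)
(* The language L_f consists of the paths on n >= 2 nodes whose node inputs give
   n and the position of the node, and whose two ends moreover hold strings x and
   y of n bits with f(x, y) = 1. The labels make this shape checkable at radius 1
   without certificates, so a protocol for f becomes a verifier in which the two
   ends play Alice and Bob. Conversely, on a path with more than 2r + 1 nodes
   every view of radius r misses one of the ends, so Alice and Bob can share the
   simulation of a verifier; the finitely many shorter paths are handled by
   guessing the whole input with the last quantifier, which is existential in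
   every class Lambda_k. *)
Require Import Defs.
From mathcomp Require Import all_boot all_order all_algebra finmap zify.
From mathcomp Require Import all_classical all_reals all_analysis.
Import Order.TTheory GRing.Theory Num.Theory.
Import numFieldNormedType.Exports.
Local Open Scope classical_set_scope.

Set Implicit Arguments.
Unset Strict Implicit.
Unset Printing Implicit Defensive.

Local Open Scope nat_scope.

(** * Alternating quantifiers over certificate strings *)

(** A quantifier over [D] can be reindexed along a map from [D'] onto [D]; this converts between
    strings of exact and of bounded length. *)
Lemma quant_map (D D' : bits -> Prop) (h : bits -> bits) :
    (forall l, D' l -> D (h l)) ->
    (forall l, D l -> exists2 l', D' l' & h l' = l) ->
  forall b k P,
    quant b k D P <-> quant b k D' (fun ls => P [seq h l | l <- ls]).
Proof.
move=> hD hsurj b k; elim: k b => [|k IHk] [] P //=; split.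
- move=> [l Dl]; have [l' Dl' <-] := hsurj l Dl.
  by move=> /(IHk false (fun ls => P (h l' :: ls))); exists l'.
- move=> [l' Dl'] /(IHk false (fun ls => P (h l' :: ls))).
  by exists (h l'); first exact: hD.
- move=> H l' Dl'; apply/(IHk true (fun ls => P (h l' :: ls))).
  exact/H/hD.
- move=> H l Dl; have [l' Dl' <-] := hsurj l Dl.
  by apply/(IHk true (fun ls => P (h l' :: ls))); exact: H.
Qed.

Lemma quant_not b k (D : bits -> Prop) P :
  (exists l, D l) -> (forall ls, ~ P ls) -> ~ quant b k D P.
Proof.
move=> [l0 Dl0]; elim: k b P => [|k IHk] b P nP; first exact: nP.
case: b => /=.
- by move=> [l _]; apply: IHk => ls; exact: nP.
- by move=> /(_ _ Dl0); apply: IHk => ls; exact: nP.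
Qed.

(** The parity makes the innermost quantifier existential, and the outer ones are vacuous because
    [D] is inhabited. In the induction the default [d] becomes the string just read. *)
Lemma quant_last k (D : bits -> Prop) (Q : bits -> Prop) d :
  (exists l, D l) ->
  quant (odd k.+1) k.+1 D (fun ls => Q (last d ls)) <-> exists2 l, D l & Q l.
Proof.
move=> [l0 Dl0]; elim: k d => [|k IHk] d //.
have -> : odd k.+2 = ~~ odd k.+1 by [].
move: IHk; case: (odd k.+1) => IHk.
- by split=> [/(_ _ Dl0) /(proj1 (IHk l0)) | Hl l _]; last exact: (proj2 (IHk l)).
- split=> [[l _ /(proj1 (IHk l))] // | Hl].
  by exists l0 => //; exact: (proj2 (IHk l0)).
Qed.

(** * Adjusting the lengths of certificates *)

(** Lets a protocol that expects exactly [m] bits run on a certificate of any length. *)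
Definition fit (m : nat) (l : bits) : bits := take m (l ++ nseq m false).

Lemma size_fit m l : size (fit m l) = m.
Proof. by rewrite size_takel // size_cat size_nseq leq_addl. Qed.

Lemma fit_id m l : size l = m -> fit m l = l.
Proof. by move=> <-; rewrite /fit take_size_cat. Qed.

(* Every [l] with [size l <= m] is [unpad (0 ... 0 1 l)] for a padding of total
   length [m + 1]: this is how strings of at most [m] bits are encoded by strings
   of exactly [m + 1] bits. *)
Definition unpad (l : bits) : bits := drop (index true l).+1 l.

Lemma size_unpad m l : size l = m.+1 -> size (unpad l) <= m.
Proof. by move=> sl; rewrite size_drop sl subSS leq_subr. Qed.

Lemma unpad_surj m l :
  size l <= m -> exists2 l', size l' = m.+1 & unpad l' = l.
Proof.
move=> lem; exists (nseq (m - size l) false ++ true :: l).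
  by rewrite size_cat size_nseq /= addnS subnK.
rewrite /unpad index_cat mem_nseq andbF size_nseq /= addn0.
by rewrite drop_cat size_nseq ltnNge leqnSn /= subSnn /= drop0.
Qed.

(** * Labelled paths and the language of a boolean function *)

(* The input of a node of a path encodes the number of nodes, the position of
   the node, and a word. *)
Definition encode_label (t : nat * nat * bits) : bits := nseq (choice.pickle t) true.

Definition decode_label (b : bits) : nat * nat * bits :=
  odflt (0, 0, [::]) (choice.unpickle (size b)).

Lemma encode_labelK : cancel encode_label decode_label.
Proof. by move=> t; rewrite /decode_label size_nseq choice.pickleK. Qed.

Definition label_length (b : bits) : nat := (decode_label b).1.1.
Definition label_pos (b : bits) : nat := (decode_label b).1.2.
Definition label_word (b : bits) : bits := (decode_label b).2.

Definition consecutive (i j : nat) : bool := (i.+1 == j) || (j.+1 == i).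

Lemma consecutive_sym : symmetric consecutive.
Proof. by move=> i j; rewrite /consecutive orbC. Qed.

Definition len (G : network) (v : G) : nat := label_length (node_input v).
Definition pos (G : network) (v : G) : nat := label_pos (node_input v).
Definition word (G : network) (v : G) : bits := label_word (node_input v).

Definition labelled_path (G : network) : Prop :=
  [/\ 1 < #|G|,
      forall v : G, len v = #|G| /\ pos v < #|G|,
      injective (@pos G)
    & forall u v : G, adj u v = consecutive (pos u) (pos v)].

Definition represents (G : network) (n : nat) (x y : n.-tuple bool) : Prop :=
  [/\ #|G| = n,
      labelled_path G
    & forall v : G, (pos v = 0 -> word v = x) /\ ((pos v).+1 = n -> word v = y)].

Lemma pos_surj (G : network) i :
  labelled_path G -> i < #|G| -> exists v : G, pos v = i.
Proof.
move=> [_ Hlt Hinj _] ltiG.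
pose F (v : G) : 'I_#|G| := Ordinal (proj2 (Hlt v)).
have Finj : injective F by move=> u v /(congr1 val) /= /Hinj.
have /codomP [v Fv] : Ordinal ltiG \in codom F.
  by apply: inj_card_onto => //; rewrite card_ord.
by exists v; have := congr1 val Fv.
Qed.

Lemma represents_inj (G : network) n (x y x' y' : n.-tuple bool) :
  represents G x y -> represents G x' y' -> x = x' /\ y = y'.
Proof.
move=> [Gn Gp Hw] [_ _ Hw']; have [lt1G _ _ _] := Gp.
have [u pu] := pos_surj Gp (ltnW lt1G).
have [v pv] : exists v : G, pos v = n.-1 by apply: pos_surj => //; lia.
split; apply: val_inj => /=.
- by rewrite -(proj1 (Hw u) pu) (proj1 (Hw' u) pu).
- have pn : (pos v).+1 = n by lia.
  by rewrite -(proj2 (Hw v) pn) (proj2 (Hw' v) pn).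
Qed.

Lemma represents_iso (G H : network) n (x y : n.-tuple bool) :
  network_iso G H -> represents G x y -> represents H x y.
Proof.
move=> [phi [phi_bij Hadj Hin _]] [Gn [lt1G Hlt Hinj Gadj] Hw].
have GH : #|H| = #|G| by rewrite (bij_eq_card phi_bij).
have [psi phiK psiK] := phi_bij.
have pE u : pos (phi u) = pos u by rewrite /pos Hin.
split; rewrite ?GH // ; last first.
  by move=> v; rewrite -[v]psiK pE /word Hin; exact: Hw.
split; rewrite ?GH //.
- by move=> v; rewrite -[v]psiK pE /len Hin; exact: Hlt.
- by move=> u v; rewrite -[u]psiK -[v]psiK !pE => /Hinj ->.
- by move=> u v; rewrite -[u]psiK -[v]psiK !pE Hadj Gadj.
Qed.

Definition path_language_of (f : boolean_function) (G : network) : Prop :=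
  exists n (x y : n.-tuple bool), represents G x y /\ f n x y = true.

Lemma path_language_iso f G H :
  network_iso G H -> path_language_of f G -> path_language_of f H.
Proof.
move=> GH [n [x [y [Gxy fxy]]]]; exists n, x, y; split=> //.
exact: represents_iso GH Gxy.
Qed.

Definition path_language (f : boolean_function) : language :=
  Language (@path_language_iso f).

Lemma path_languageE f (G : network) n (x y : n.-tuple bool) :
  represents G x y -> path_language f G <-> f n x y = true.
Proof.
move=> Gxy; split=> [[n' [x' [y' [Gxy' fxy]]]]|fxy]; last by exists n, x, y.
have [Gn _ _] := Gxy; have [Gn' _ _] := Gxy'.
move: Gn Gn' => -> nn'; case: _ / nn' in x' y' Gxy' fxy *.
by have [-> ->] := represents_inj Gxy Gxy'.
Qed.

(** * Recognising labelled paths at radius 1 *)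

(** The claimed length [len v] stands for the number of nodes, which a node cannot see. The last
    clause prevents the path from breaking off before that length. *)
Definition locally_path (G : network) (v : G) : Prop :=
  [/\ 1 < len v, pos v < len v,
      forall u, u \in nbhd 1 v ->
        [/\ len u = len v, pos u <= (pos v).+1 & pos v <= (pos u).+1],
      {in nbhd 1 v &, injective (@pos G)}
    & forall j, j < len v -> j <= (pos v).+1 -> pos v <= j.+1 ->
        exists2 u, u \in nbhd 1 v & pos u = j].

Lemma in_nbhd1 (G : network) (u v : G) :
  (u \in nbhd 1 v) = (u == v) || adj v u.
Proof.
rewrite !inE; congr (_ || _); apply/existsP/idP => [[w]|vu].
  by rewrite inE => /andP[/eqP ->].
by exists v; rewrite inE eqxx.
Qed.

Lemma labelled_path_local (G : network) (v : G) :
  labelled_path G -> locally_path v.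
Proof.
move=> Gp; have [lt1 Hlt Hinj Hadj] := Gp.
have [lenv posv] := Hlt v.
split; rewrite ?lenv //.
- move=> u; rewrite in_nbhd1 Hadj; have [-> posu] := Hlt u.
  by case/orP => [/eqP ->|/orP[/eqP ?|/eqP ?]]; split=> //; lia.
- by move=> u w _ _; exact: Hinj.
- move=> j ltj le1 le2; have [u pu] := pos_surj Gp ltj; exists u => //.
  rewrite in_nbhd1 Hadj /consecutive pu.
  have [pj|npj] := eqVneq j (pos v); last by apply/orP; right; lia.
  by rewrite (Hinj u v) ?eqxx // pu.
Qed.

Lemma closed_full (G : network) (P : G -> Prop) (v0 : G) :
  P v0 -> (forall u v, adj u v -> P u -> P v) -> forall v, P v.
Proof.
move=> P0 Pc v; have /connectP [p] := @adj_connected G v0 v.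
elim: p v0 P0 => [|w p IHp] v0 P0 /=; first by move=> _ ->.
by case/andP=> /Pc /(_ P0); exact: IHp.
Qed.

(** The claimed lengths agree by connectedness. Descending reaches a node at position 0, and the
    walk [phi] upwards from it inverts [pos]: the nodes with [phi (pos v) = v] are closed under
    adjacency, as positions are locally distinct. *)
Lemma local_labelled_path (G : network) :
  (forall v : G, locally_path v) -> labelled_path G.
Proof.
move=> loc.
have nbr (u v : G) : adj u v -> v \in nbhd 1 u by rewrite in_nbhd1 orbC => ->.
have self1 (v : G) : v \in nbhd 1 v by rewrite in_nbhd1 eqxx.
have [v1] : exists v1 : G, true.
  by have /card_gt0P [v _] := node_gt0 G; exists v.
move=> _; pose n := len v1.
have lenE : forall v : G, len v = n.
  apply: closed_full; first by reflexivity.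
  by move=> u v uv; have [_ _ /(_ v (nbr _ _ uv)) [-> _ _] _ _] := loc u.
have posn (v : G) : pos v < n by have [_ + _ _ _] := loc v; rewrite lenE.
have lt1n : 1 < n by have [+ _ _ _ _] := loc v1.
have inj1 (v u w : G) : u \in nbhd 1 v -> w \in nbhd 1 v -> pos u = pos w -> u = w.
  by have [_ _ _ H _] := loc v; move=> ? ?; exact: H.
have adj_consec (u v : G) : adj u v -> consecutive (pos u) (pos v).
  move=> uv; have vu1 := nbr _ _ uv.
  have [_ _ /(_ v vu1) [_ le1 le2] _ _] := loc u.
  have : pos u != pos v.
    by apply/eqP => /(inj1 u _ _ (self1 u) vu1) E; move: uv; rewrite E adj_irr.
  by rewrite /consecutive; lia.
have nbr_at (v : G) j : j < n -> consecutive (pos v) j ->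
    exists2 u, adj v u & pos u = j.
  move=> ltj cj; have [_ _ _ _ /(_ j)] := loc v.
  rewrite lenE => /(_ ltj) H.
  have [||u] := H; [by move: cj; rewrite /consecutive; lia..|].
  rewrite in_nbhd1 => /orP[/eqP ->|vu] pu; last by exists u.
  by move: cj; rewrite -pu /consecutive; lia.
have [v0 pv0] : exists v0 : G, pos v0 = 0.
  have H m : forall v : G, pos v = m -> exists v0 : G, pos v0 = 0.
    elim: m => [|m IHm] v pv; first by exists v.
    have [||u _ /IHm //] := nbr_at v m.
      by apply: ltn_trans (posn v); rewrite pv.
    by rewrite /consecutive pv eqxx orbT.
  exact: H (pos v1) v1 erefl.
(* The default [v] is reached only at the last position, which has no successor. *)
pose next (v : G) := odflt v [pick u | adj v u && (pos u == (pos v).+1)].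
pose phi j := iter j next v0.
have nextP (v : G) : (pos v).+1 < n -> adj v (next v) /\ pos (next v) = (pos v).+1.
  move=> ltn; rewrite /next; case: pickP => [u /andP[vu /eqP pu] //|none].
  have [|u vu pu] := nbr_at v _ ltn; first by rewrite /consecutive eqxx.
  by have := none u; rewrite vu pu eqxx.
have pos_phi j : j < n -> pos (phi j) = j.
  elim: j => // j IHj ltj; have pj := IHj (ltnW ltj).
  by have [|_] := nextP (phi j); rewrite pj.
have posK (v : G) : phi (pos v) = v.
  apply: (closed_full (P := fun v => phi (pos v) = v) (v0 := v0)) v.
    by rewrite pv0.
  (* In both cases [phi (pos v)] and [v] are neighbours of [u] at the same position, so they
     coincide. *)
  move=> u v uv phiu; have /orP[/eqP E|/eqP E] := adj_consec u v uv.
  - have [|a p] := nextP u; first by rewrite E.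
    rewrite -E -[phi _]/(next (phi (pos u))) phiu.
    by apply: (inj1 u); rewrite ?p ?E // nbr.
  - have [|a p] := nextP (phi (pos v)); first by rewrite pos_phi // E.
    move: a; rewrite -[next _]/(phi (pos v).+1) E phiu => a.
    by apply: (inj1 u); rewrite ?nbr ?pos_phi // adj_sym.
have posI : injective (@pos G) by exact: can_inj posK.
have cardG : #|G| = n.
  pose F (v : G) : 'I_n := Ordinal (posn v).
  rewrite -[RHS]card_ord; apply: (@bij_eq_card _ _ F).
  exists (fun i : 'I_n => phi i) => [v|i]; first exact: posK.
  by apply: val_inj; rewrite /= pos_phi.
split; rewrite ?cardG // => u v; apply/idP/idP; first exact: adj_consec.
by move=> /(nbr_at u _ (posn v)) [w uw /posI <-].
Qed.

(** * From protocols to verifiers *)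

Definition path_view (S : {fset nat * bits}) (b : bits) : Prop :=
  [/\ 1 < label_length b, label_pos b < label_length b,
      forall p, p \in S ->
        [/\ label_length p.2 = label_length b,
            label_pos p.2 <= (label_pos b).+1
          & label_pos b <= (label_pos p.2).+1],
      {in S &, injective (fun p : nat * bits => label_pos p.2)}
    & forall j, j < label_length b -> j <= (label_pos b).+1 ->
        label_pos b <= j.+1 -> exists2 p, p \in S & label_pos p.2 = j].

Lemma in_seen_nodes (G : network) (id : G -> nat) r (v : G) p :
  p \in seen_nodes (local_view id r v) <->
  exists2 u, u \in nbhd r v & p = (id u, node_input u).
Proof.
split=> [/imfsetP [u /= uv ->]|[u uv ->]]; first by exists u.
by apply/imfsetP; exists u.
Qed.

(** Distinct identifiers keep apart neighbours with equal inputs, so a repeated position near [v]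
    shows up in the view. *)
Lemma path_viewP (G : network) (id : G -> nat) (v : G) : injective id ->
  path_view (seen_nodes (local_view id 1 v)) (node_input v) <-> locally_path v.
Proof.
move=> id_inj; split=> -[lt1 ltv Hnb Hinj Hex]; split=> //.
- move=> u uv; have /Hnb // : (id u, node_input u) \in
    seen_nodes (local_view id 1 v) by apply/in_seen_nodes; exists u.
- move=> u w uv wv uw; apply: id_inj.
  have [] // : (id u, node_input u) = (id w, node_input w).
  by apply: Hinj => //; apply/in_seen_nodes; [exists u | exists w].
- move=> j ltj le1 le2; have [p /in_seen_nodes [u uv ->] pj] := Hex j ltj le1 le2.
  by exists u.
- by move=> p /in_seen_nodes [u /Hnb + ->].
- move=> p q /in_seen_nodes [u uv ->] /in_seen_nodes [w wv ->] /= uw.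
  by rewrite (Hinj u w uv wv uw).
- move=> j ltj le1 le2; have [u uv pu] := Hex j ltj le1 le2.
  by exists (id u, node_input u) => //; apply/in_seen_nodes; exists u.
Qed.

(** A label may carry a word of any length; those without exactly [n] bits fail here. *)
Definition holds_word (w : bits) n (P : n.-tuple bool -> bool) : Prop :=
  exists2 x : n.-tuple bool, w = x & P x = true.

(** The node finds its own input under its identifier and reads [n] off the label, since the size of
    the network is hidden from it. *)
Definition path_verifier (s : nat -> nat)
    (A B : forall n, seq bits -> n.-tuple bool -> bool)
    (w : view) (ls : seq bits) : bool :=
  `[< forall b, (self w, b) \in seen_nodes w ->
      let n := label_length b in
      let ls' := [seq fit (s n) l | l <- ls] in
      [/\ path_view (seen_nodes w) b,
          label_pos b = 0 -> holds_word (label_word b) (@A n ls')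
        & (label_pos b).+1 = n -> holds_word (label_word b) (@B n ls')] >].

Lemma path_verifierP s A B (G : network) (id : G -> nat) (v : G) ls :
  injective id ->
  path_verifier s A B (local_view id 1 v) ls = true <->
  [/\ locally_path v,
      pos v = 0 ->
        holds_word (word v) (@A (len v) [seq fit (s (len v)) l | l <- ls])
    & (pos v).+1 = len v ->
        holds_word (word v) (@B (len v) [seq fit (s (len v)) l | l <- ls])].
Proof.
move=> id_inj; split.
- move=> /asboolP /(_ (node_input v)) [|/path_viewP Hp HA HB].
    by apply/in_seen_nodes; exists v; rewrite ?in_nbhd1 ?eqxx.
  by split=> //; exact: Hp.
- move=> [Hp HA HB]; apply/asboolP => b /in_seen_nodes [u _ [/id_inj vu ->]].
  by rewrite -vu; split=> //; apply/path_viewP.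
Qed.

(** The nodes at positions 0 and [#|G|.-1] provide the words of Alice and Bob and run their
    algorithms; all nodes check the shape. *)
Lemma path_verifier_all s A B (G : network) (id : G -> nat) ls :
  injective id ->
  (forall v : G, path_verifier s A B (local_view id 1 v) ls = true) <->
  exists x y : #|G|.-tuple bool,
    [/\ represents G x y,
        A _ [seq fit (s #|G|) l | l <- ls] x = true
      & B _ [seq fit (s #|G|) l | l <- ls] y = true].
Proof.
move=> id_inj; split=> [H|[x [y [[_ Gp Hw] Ax By]]] v].
- have Gp : labelled_path G.
    by apply: local_labelled_path => v; have /path_verifierP [] := H v.
  have [lt1 Hlt Hinj _] := Gp.
  have [u pu] := pos_surj Gp (ltnW lt1).
  have [v pv] : exists v : G, pos v = #|G|.-1 by apply: pos_surj => //; lia.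
  have pvS : (pos v).+1 = #|G| by rewrite pv prednK // ltnW.
  have /path_verifierP [//|_ /(_ pu) + _] := H u.
  have /path_verifierP [//|_ _] := H v.
  rewrite (proj1 (Hlt v)) (proj1 (Hlt u)) => /(_ pvS) [y wy By] [x wx Ax].
  exists x, y; split=> //; split=> // w; split=> pw.
    by rewrite -wx; congr word; apply: Hinj; rewrite pw.
  rewrite -wy; congr word; apply: Hinj.
  by apply: succn_inj; rewrite pw.
- have [_ /(_ v) [lenv _] _ _] := Gp.
  apply/path_verifierP => //; rewrite lenv; split.
  + exact: labelled_path_local.
  + by move=> /(proj1 (Hw v)) ->; exists x.
  + by move=> /(proj2 (Hw v)) ->; exists y.
Qed.

(** * Concrete paths and the locality of their views *)

Section PathNetwork.
Variables (m : nat) (inp : 'I_m.+1 -> bits).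

Definition path_adj : rel 'I_m.+1 := fun i j => consecutive i j.

Lemma path_adj_sym : symmetric path_adj.
Proof. by move=> i j; exact: consecutive_sym. Qed.

Lemma path_adj_irr : irreflexive path_adj.
Proof. by move=> i; rewrite /path_adj /consecutive; lia. Qed.

Lemma path_adj_connected i j : connect path_adj i j.
Proof.
have sym : symmetric (connect path_adj) by apply/sym_connect_sym/path_adj_sym.
suff H (k : 'I_m.+1) : connect path_adj ord0 k.
  by apply: connect_trans (H j); rewrite sym.
case: k; elim=> [|k IHk] ltk; first by rewrite (_ : Ordinal _ = ord0) //; apply: val_inj.
apply: connect_trans (IHk (ltnW ltk)) (connect1 _).
by rewrite /path_adj /consecutive /= eqxx.
Qed.

Lemma card_ordS_gt0 : 0 < #|'I_m.+1|.
Proof. by rewrite card_ord. Qed.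

Definition path_network : network :=
  @Network 'I_m.+1 path_adj inp (fun _ _ => [::]) path_adj_sym path_adj_irr
    (fun _ _ => erefl) card_ordS_gt0 path_adj_connected.

Lemma nbhd_path_dist r (u v : path_network) :
  u \in nbhd r v -> (u <= v + r) && (v <= u + r).
Proof.
elim: r u => [|r IHr] u.
  by rewrite inE => /eqP ->; rewrite addn0 leqnn.
rewrite !inE => /orP[/IHr|/existsP [w /andP[/IHr + ]]]; first lia.
by rewrite /= /path_adj /consecutive; lia.
Qed.

End PathNetwork.

Lemma nbhd_path m (inp inp' : 'I_m.+1 -> bits) r (v : 'I_m.+1) :
  @nbhd (path_network inp) r v = @nbhd (path_network inp') r v.
Proof.
elim: r => [|r IHr] //=; rewrite IHr; congr (_ :|: _)%SET.
Qed.

(** Neighbourhoods and edges do not depend on the node inputs, and a node within [r] steps has a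
    position within [r]. *)
Lemma local_view_path m (inp inp' : 'I_m.+1 -> bits) (id : 'I_m.+1 -> nat) r
    (v : 'I_m.+1) :
    (forall u : 'I_m.+1, u <= v + r -> v <= u + r -> inp u = inp' u) ->
  @local_view (path_network inp) id r v = @local_view (path_network inp') id r v.
Proof.
move=> inpE; rewrite /local_view; congr View.
- apply/fsetP => p; apply/imfsetP/imfsetP => -[/= u uv ->];
    have /andP[le1 le2] := nbhd_path_dist uv; exists u.
  + by rewrite /= (nbhd_path inp' inp).
  + by congr (_, _); exact: inpE.
  + by rewrite /= (nbhd_path inp inp').
  + by congr (_, _); exact/esym/inpE.
- apply/fsetP => p; apply/imfsetP/imfsetP => -[/= e ev ->]; exists e => //=;
    by move: ev; rewrite (nbhd_path inp inp').
Qed.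

(** * From verifiers to protocols *)

Definition end_input (n : nat) (x y : bits) (i : nat) : bits :=
  encode_label (n, i, if i == 0 then x else if i.+1 == n then y else [::]).

Definition end_path m (x y : bits) : network :=
  path_network (fun i : 'I_m.+1 => end_input m.+1 x y i).

Lemma represents_end_path m (x y : m.+1.-tuple bool) :
  0 < m -> represents (end_path m x y) x y.
Proof.
move=> m0.
have lab (i : 'I_m.+1) :
    decode_label (@node_input (end_path m x y) i) =
    (m.+1, nat_of_ord i,
      if val i == 0 then tval x else if (val i).+1 == m.+1 then tval y else [::]).
  by rewrite encode_labelK.
have posE (i : 'I_m.+1) : @pos (end_path m x y) i = i.
  by rewrite /pos /label_pos lab.
split; rewrite ?card_ord //.
  split; rewrite ?card_ord ?ltnS //.
  - by move=> i; rewrite posE /len /label_length lab.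
  - by move=> i j; rewrite !posE => /val_inj.
  - by move=> i j; rewrite !posE.
move=> i; rewrite posE /word /label_word lab /=; split=> [->|Ei] //.
by rewrite Ei eqxx; case: eqP => // i0; move: Ei; rewrite i0; lia.
Qed.

(* Alice simulates the nodes at distance more than [r] from the right end, with a
   dummy word there; Bob does the same from the left end. *)
Lemma simulate_verifier m r (A : view -> seq bits -> bool) : r.*2 < m ->
  exists A' B' : seq bits -> m.+1.-tuple bool -> bool,
    forall (x y : m.+1.-tuple bool) ls,
      (A' ls x = true /\ B' ls y = true) <->
      (forall v : end_path m x y,
         A (@local_view (end_path m x y) (@nat_of_ord m.+1) r v) ls = true).
Proof.
move=> lt_r_m.
pose vw x y := @local_view (end_path m x y) (@nat_of_ord m.+1) r.
exists (fun ls x => `[< forall v : 'I_m.+1, v + r < m ->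
  A (vw x [::] v) ls = true >]).
exists (fun ls y => `[< forall v : 'I_m.+1, r < v ->
  A (vw [::] y v) ls = true >]).
move=> x y ls.
have left (v : 'I_m.+1) : v + r < m -> vw x [::] v = vw x y v.
  move=> ltv; apply: local_view_path => u le1 le2.
  rewrite /end_input; case: eqP => // _; case: eqP => //; lia.
have right (v : 'I_m.+1) : r < v -> vw [::] y v = vw x y v.
  move=> ltv; apply: local_view_path => u le1 le2.
  rewrite /end_input; case: eqP => //; lia.
split=> [[/asboolP HA /asboolP HB] v|H].
  have [ltv|lev] := ltnP (v + r) m; first by rewrite -/(vw x y v) -left ?HA.
  (* Here [m <= v + r] and [r.*2 < m] give [r < v], so Bob covers this node. *)
  by rewrite -/(vw x y v) -right ?HB //; lia.
split; apply/asboolP => v Hv; first by rewrite left //; exact: H.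
by rewrite right //; exact: H.
Qed.

(** The last string, existentially quantified, is guessed to be [x ++ y], hence the length [n.*2].
    Alice checks her half and the value of [f], Bob checks his half. *)
Lemma guess_input (f : boolean_function) n k :
  exists A B : seq bits -> n.-tuple bool -> bool,
    forall x y : n.-tuple bool,
      f n x y = true <->
      quant (odd k.+1) k.+1 (fun l => size l = n.*2)
        (fun ls => A ls x = true /\ B ls y = true).
Proof.
exists (fun ls (x : n.-tuple bool) => `[< exists2 y : n.-tuple bool,
  last [::] ls = x ++ y & f n x y = true >]).
exists (fun ls (y : n.-tuple bool) => `[< exists x : n.-tuple bool, last [::] ls = x ++ y >]).
move=> x y.
pose Q l := `[< exists2 y : n.-tuple bool, l = x ++ y & f n x y = true >] = true
  /\ `[< exists x : n.-tuple bool, l = x ++ y >] = true.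
have := @quant_last k (fun l => size l = n.*2) Q [::].
rewrite /Q => -> //; last by exists (nseq n.*2 false); rewrite size_nseq.
split=> [fxy|[l _ [/asboolP [y' -> fxy'] /asboolP [x' /eqP]]]].
  exists (x ++ y); first by rewrite size_cat !size_tuple addnn.
  by split; apply/asboolP; [exists y | exists x].
by rewrite eqseq_cat ?size_tuple // => /andP[_ /eqP/val_inj <-].
Qed.

(** * Growth of the certificate sizes, and the equivalence *)

Local Open Scope ring_scope.

(** Dominating the logarithm, [g] is eventually bounded away from 0 and absorbs one extra bit.
    Agreement near infinity leaves finitely many lengths free. *)
Lemma bigO_succ (R : realType) (g : nat -> R) (s t : nat -> nat) :
    g =Omega_\oo (fun n => ln n%:R : R) ->
    bigO_of g s -> (\forall n \near \oo, t n = (s n).+1) ->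
  bigO_of g t.
Proof.
rewrite eqOmegaE eqOmegaO => /eqO_exP [c c0 lnO] /eqO_exP [k k0 sO] ts.
have ln2 : 0 < ln 2 :> R by rewrite ln_gt0 // ltr1n.
(* [k] pays for [s n], the second summand for the extra bit, as eventually
   [ln 2 <= ln n <= c * |g n|]. *)
apply/eqO_exP; exists (k + (ln 2)^-1 * c).
  by rewrite addr_gt0 // mulr_gt0 // invr_gt0.
near=> n.
have -> : t n = (s n).+1 by near: n.
have sn : `|(s n)%:R : R| <= k * `|g n| by near: n.
have lnn : `|ln n%:R : R| <= c * `|g n| by near: n.
have n2 : (2 <= n)%N by near: n; exact: nbhs_infty_ge.
rewrite mulrDl -addn1 natrD (le_trans (ler_normD _ _)) // lerD // normr1.
rewrite -mulrA ler_pdivlMl // mulr1 (le_trans _ lnn) // (le_trans _ (ler_norm _)) //.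
by rewrite ler_ln ?posrE ?ltr0n ?ler_nat // ltnW.
Unshelve. all: by end_near. Qed.

Theorem theorem20 (R : realType) (N : nat -> nat) (hN : polynomial_range N)
    (f : boolean_function) (g : nat -> R)
    (hg : g =Omega_\oo (fun n => ln n%:R : R)) :
  exists L : language, forall k : nat, (1 <= k)%N ->
    (Lambda_G N k g L <->
     if odd k then Sigma_cc_O k g f else Pi_cc_O k g f).
Proof.
exists (path_language f) => -[//|k] _.
suff H : global_level N (odd k.+1) k.+1 g (path_language f) <->
    exists2 s, bigO_of g s & cc_level (odd k.+1) k.+1 s f.
  by rewrite /Lambda_G; case: (odd k.+1) H.
split.
- move=> [s sO [r [A HA]]].
  (* On short paths [n.*2] bits hold the whole input; on the others one more bit encodes, through
     [unpad], the strings of at most [s n] bits. *)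
  exists (fun n => if (n <= r.*2.+1)%N then n.*2 else (s n).+1).
    apply: bigO_succ hg sO _; near=> n; rewrite leqNgt ifN // negbK.
    by near: n; exact: nbhs_infty_gt.
  pose protocol n := (seq bits -> n.-tuple bool -> bool)%type.
  (* Protocols may depend arbitrarily on [n], so one is found for each length and choice assembles
     them. *)
  suff H n : exists AB : protocol n * protocol n, forall x y : n.-tuple bool,
      f n x y = true <->
      quant (odd k.+1) k.+1
        (fun l => size l = if (n <= r.*2.+1)%N then n.*2 else (s n).+1)
        (fun ls => AB.1 ls x = true /\ AB.2 ls y = true).
    exists (fun n => (projT1 (cid (H n))).1), (fun n => (projT1 (cid (H n))).2).
    by move=> n; exact: projT2 (cid (H n)).
  have [le_n|] := leqP n r.*2.+1.
    by have [A' [B' HAB]] := guess_input f n k; exists (A', B').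
  case: n => // m; rewrite ltnS => lt_r_m.
  have [A' [B' HAB]] := @simulate_verifier m r A lt_r_m.
  exists ((fun ls => A' [seq unpad l | l <- ls]),
          (fun ls => B' [seq unpad l | l <- ls])) => x y.
  have m0 : (0 < m)%N by exact: leq_ltn_trans lt_r_m.
  (* Positions serve as identifiers known to both players; [n <= N n] puts them in range. *)
  have id_path : @identifiers N (end_path m x y) (@nat_of_ord m.+1).
    split; first exact: val_inj.
    by move=> v; rewrite card_ord (leq_trans (ltn_ord v)) // (proj1 hN).
  rewrite -(path_languageE f (represents_end_path x y m0)) (HA _ _ id_path).
  rewrite card_ord (quant_map (@size_unpad (s m.+1)) (@unpad_surj (s m.+1))).
  have <- : (fun ls => A' [seq unpad l | l <- ls] x = true /\
      B' [seq unpad l | l <- ls] y = true) =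
    (fun ls => forall v : end_path m x y,
      A (@local_view (end_path m x y) (@nat_of_ord m.+1) r v)
        [seq unpad l | l <- ls] = true) => //.
  by apply/funext => ls; apply/propext; exact: HAB.
- move=> [s sO [A [B HAB]]]; exists s => //.
  exists 1%N, (path_verifier s A B) => G id [id_inj _].
  have qE P : (quant (odd k.+1) k.+1 (fun l => size l = s #|G|) P <->
    quant (odd k.+1) k.+1 (fun l => (size l <= s #|G|)%N)
      (fun ls => P [seq fit (s #|G|) l | l <- ls])).
    apply: quant_map => [l _|l sl]; first exact: size_fit.
    by exists l; rewrite ?sl ?fit_id.
  (* A network that represents a pair is decided by the protocol; any other must be rejected under
     all certificates. *)
  have [[x [y Gxy]]|nG] := pselect (exists x y : #|G|.-tuple bool, represents G x y).
    rewrite (path_languageE f Gxy) HAB qE.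
    suff -> : (fun ls => A #|G| [seq fit (s #|G|) l | l <- ls] x = true /\
        B #|G| [seq fit (s #|G|) l | l <- ls] y = true) =
      (fun ls => forall v : G,
        path_verifier s A B (local_view id 1 v) ls = true) by [].
    apply/funext => ls; apply/propext; rewrite path_verifier_all //.
    (* The pair found by the verifier is [(x, y)], since a network represents at most one pair. *)
    split=> [[Ax By]|[x' [y' [Gxy' Ax By]]]]; first by exists x, y.
    by have [-> ->] := represents_inj Gxy Gxy'.
  split=> [[n [x [y [Gxy _]]]]|].
    have [Gn _ _] := Gxy; subst n; by case: nG; exists x, y.
  move=> Q; exfalso; move: Q; apply: quant_not; first by exists [::].
  move=> ls /path_verifier_all [//|x [y [Gxy _ _]]].
  by apply: nG; exists x, y.
Unshelve. all: by end_near. Qed.
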